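(* Let $I_i=I\cap K[X\setminus\{x_i\}]$ for $i=1,\ldots,n$. If $I$ is an unmixed ideal such that the following conditions hold: (a$_1$) $Q(A)$ is integral, (a$_2$) $I_i$ is normal for $i=1,\ldots,n$, and (a$_3$) $\mathcal C$ has the König property, then $R[It]$ is normal.
   Context: Let $R=K[x_1,\ldots,x_n]$ be a polynomial ring over a field $K$, $X=\{x_1,\ldots,x_n\}$, and let $I\subset R$ be an ideal of height $g\ge 2$ minimally generated by a finite set $F=\{x^{v_1},\ldots,x^{v_q}\}$ of square-free monomials of degree at least two (where $x^a=x_1^{a_1}\cdots x_n^{a_n}$). Each variable $x_i$ divides at least one monomial of $F$. $\mathcal C$ is the clutter with vertex set $X$ whose edges are the supports $\mathrm{supp}(x^{v_k})$ (sets of variables dividing $x^{v_k}$), $k=1,\ldots,q$. Let $A$ be the $n\times q$ matrix with column vectors $v_1,\ldots,v_q$. The set covering polyhedron is $Q(A)=\{x\in\mathbb R^n\mid x\ge 0,\ xA\ge\mathbf 1\}$, $\mathbf 1=(1,\ldots,1)$; it is integral if all its vertices have integral entries. A vertex cover of $\mathcal C$ is a subset of $X$ meeting every edge; it is minimal if no proper subset is a vertex cover. $I$ is unmixed if all minimal vertex covers of $\mathcal C$ have the same cardinality. $\alpha_0(\mathcal C)$ is the minimum cardinality of a vertex cover and $\beta_1(\mathcal C)$ is the maximum number of pairwise disjoint edges; $\mathcal C$ has the König property if $\alpha_0(\mathcal C)=\beta_1(\mathcal C)$. $I_i$ is an ideal of the polynomial ring $K[X\setminus\{x_i\}]$. An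 ideal $J$ is normal if $J^k=\overline{J^k}$ (integral closure) for all $k\ge 1$. The Rees algebra is $R[It]=R\oplus It\oplus I^2t^2\oplus\cdots\subset R[t]$; it is normal if it is integrally closed in its field of fractions. *)

(* Defs.v *)
From HB Require Import structures.
From mathcomp Require Import all_boot all_order all_algebra.
From mathcomp Require Import reals.
From mathcomp Require Import fraction mpoly.

Set Implicit Arguments.
Unset Strict Implicit.
Unset Printing Implicit Defensive.

Import Order.TTheory GRing.Theory Num.Theory.
Local Open Scope ring_scope.

(* Ideals are predicates [T -> Prop] up to pointwise equivalence, since
   membership need not be decidable. *)

Section Ideals.
Variable T : comNzRingType.
Implicit Types (I J P Q S : T -> Prop).

Definition incl S S' := forall x, S x -> S' x.

Definition is_ideal I :=
  [/\ I 0, (forall x y, I x -> I y -> I (x + y)) &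
      (forall a x, I x -> I (a * x))].

Definition is_prime_ideal P :=
  [/\ is_ideal P, ~ P 1 & (forall x y, P (x * y) -> P x \/ P y)].

Definition ideal_gen S : T -> Prop := fun x =>
  exists (m : nat) (c s : 'I_m -> T),
    (forall j, S (s j)) /\ x = \sum_(j < m) c j * s j.

Definition ideal_mul I J : T -> Prop :=
  ideal_gen (fun z => exists x y, [/\ I x, J y & z = x * y]).

(* [ideal_pow I 0] is the unit ideal. *)
Fixpoint ideal_pow I (k : nat) : T -> Prop :=
  if k is k'.+1 then ideal_mul I (ideal_pow I k') else (fun _ => True).

Definition minimally_generates S I :=
  (forall x, I x <-> ideal_gen S x) /\
  (forall S', incl S' S -> incl I (ideal_gen S') -> incl S S').

(* [c 0 < c 1 < ... < c k = P] is a strict chain of prime ideals. *)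
Definition prime_height_ge P (k : nat) :=
  exists c : nat -> T -> Prop,
    [/\ (forall j, (j <= k)%N -> is_prime_ideal (c j)),
        (forall j, (j < k)%N -> incl (c j) (c j.+1) /\ ~ incl (c j.+1) (c j)) &
        (forall x, c k x <-> P x)].

(* The height of an ideal is the minimum of the heights of the primes
   containing it. *)
Definition has_height I (g : nat) :=
  (forall P, is_prime_ideal P -> incl I P -> prime_height_ge P g) /\
  (exists P, [/\ is_prime_ideal P, incl I P & ~ prime_height_ge P g.+1]).

Definition integral_closure J : T -> Prop := fun x =>
  exists (m : nat) (a : nat -> T),
    [/\ (0 < m)%N,
        (forall j, (1 <= j <= m)%N -> ideal_pow J j (a j)) &
        x ^+ m + \sum_(1 <= j < m.+1) a j * x ^+ (m - j) = 0].

Definition normal_ideal J :=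
  forall k, (1 <= k)%N ->
    forall x, ideal_pow J k x <-> integral_closure (ideal_pow J k) x.

(* R[It] inside R[t] = {poly T} *)
Definition rees_algebra I : {poly T} -> Prop :=
  fun f => forall k, ideal_pow I k f`_k.

End Ideals.

(* For a subring S of a domain D, Frac(S) is the subfield of {fraction D}
   consisting of the quotients a / b with a, b in S and b <> 0. *)
Definition normal_subring (D : idomainType) (S : D -> Prop) :=
  forall a b : D, S a -> S b -> b != 0 ->
    (exists p : {poly D},
       [/\ p \is monic, (forall j, S p`_j) &
           root (map_poly (@tofrac D) p) (tofrac a / tofrac b)]) ->
    exists2 c : D, S c & tofrac a / tofrac b = tofrac c.

Section Polynomials.
Variables (K : fieldType) (n : nat).

(* I :&: K[X \ {x_i}], where K[X \ {x_i}] is the polynomial ring in n - 1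
   variables whose j-th variable is sent to x_(lift i j). *)
Definition elim_var (I : {mpoly K[n]} -> Prop) (i : 'I_n) :
    {mpoly K[n.-1]} -> Prop :=
  fun p => I (p \mPo [tuple 'X_(lift i j) | j < n.-1]).

End Polynomials.

Definition mnm_supp (n : nat) (m : 'X_{1..n}) : {set 'I_n} :=
  [set i | m i != 0%N].

Section Clutters.
Variable V : finType.
Implicit Types (E : {set {set V}}) (C : {set V}).

Definition vertex_cover E C := [forall e in E, C :&: e != set0].

Definition minimal_vertex_cover E C := minset (vertex_cover E) C.

Definition unmixed E :=
  forall C C', minimal_vertex_cover E C -> minimal_vertex_cover E C' ->
    #|C| = #|C'|.

(* The neutral element #|V| is harmless: it bounds the size of every cover. *)
Definition alpha0 E : nat :=
  \big[minn/#|V|]_(C : {set V} | vertex_cover E C) #|C|.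

Definition beta1 E : nat :=
  \max_(M : {set {set V}} | (M \subset E) && trivIset M) #|M|.

Definition konig E := alpha0 E = beta1 E.

End Clutters.

Definition clutter_of (n q : nat) (v : 'I_q -> 'X_{1..n}) : {set {set 'I_n}} :=
  [set mnm_supp (v k) | k : 'I_q].

Section Polyhedra.
Variables (R : realType) (n : nat).
Implicit Types (P : 'rV[R]_n -> Prop) (x : 'rV[R]_n).

(* A vertex is a face of dimension 0: {x} is the set of points of P where
   some linear functional c attains its minimum over P. *)
Definition is_vertex P x :=
  P x /\ exists c : 'cV[R]_n,
    forall y, P y -> y != x -> (x *m c) 0 0 < (y *m c) 0 0.

Definition integral_polyhedron P :=
  forall x, is_vertex P x -> forall i, x 0 i \is a Num.int.

Definition set_covering_polyhedron (q : nat) (A : 'M[R]_(n, q)) :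
    'rV[R]_n -> Prop :=
  fun x => (forall i, 0 <= x 0 i) /\ (forall k, 1 <= (x *m A) 0 k).

End Polyhedra.

Definition exponent_matrix (R : realType) (n q : nat)
    (v : 'I_q -> 'X_{1..n}) : 'M[R]_(n, q) :=
  \matrix_(i < n, k < q) (v k i)%:R.

(* Main.v *)
Require Import Defs.
From HB Require Import structures.
From mathcomp Require Import all_boot all_order all_algebra.
From mathcomp Require Import boolp reals.
From mathcomp Require Import fraction mpoly.
From mathcomp Require Import ring lra zify.

(** Write [covers_ge v a b] when every vertex cover C of the clutter satisfies
    b <= sum of the a i, i in C, and let the cover algebra be the span in R[t]
    of the monomials x^a t^b with [covers_ge v a b]. The proof shows that the
    Rees algebra is the cover algebra ([rees_algebraE]) and that the cover
    algebra is normal ([normal_cover_algebra]).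

    Every power I^b lies in the span of the x^a with [covers_ge v a b], since a
    cover meets each edge ([pow_cover_ideal]). Conversely [covers_ge v a b]
    implies that x^a lies in I^b, by induction on b ([mem_pow_covers]).

    If some a i is 0, then x^a lives in the ring without x_i. Integrality of
    Q(A) says that the minimum of a . x over Q(A), being attained at a vertex,
    is attained at a point whose support is a vertex cover, hence is at least
    b; by linear programming duality ([farkas]), for some N > 0 the monomial
    x^(N a) is a multiple of a product of at least N b edge monomials
    ([nat_packing]). This makes x^a integral over I_i^b, and I_i is normal
    ([mem_pow_zero_coord]).

    If all a i are positive, the product of all the variables can be split off.
    A maximum matching M has as many edges as a minimal cover has vertices, by
    the Konig property and unmixedness. Each edge of M takes one vertex of the
    cover, so that every minimal cover is contained in the union of M; as every
    vertex lies on a minimal cover, M partitions the vertices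
    ([konig_perfect_matching]). Hence x_1 ... x_n is a product of #|M|
    generators, while subtracting 1 from all the a i lowers the sum over a
    minimal cover by exactly #|M|.

    Normality of the cover algebra is obtained without passing through the
    normality of R[t]. If f / g is integral, then for some nonzero d every
    d (f / g)^N lies in the cover algebra. Comparing leading exponents and
    letting N grow shows that the difference of the leading exponents of f and
    g satisfies the linear inequalities that define the cover algebra
    ([covers_ge_direction]); so one step of the division of f by g can be
    carried out inside the cover algebra, it preserves the hypothesis on f, and
    the division ends with remainder 0 ([cover_algebra_div]). *)

Set Implicit Arguments.
Unset Strict Implicit.
Unset Printing Implicit Defensive.

Import Order.TTheory GRing.Theory Num.Theory.
Local Open Scope ring_scope.

(** * Powers of ideals *)

Section IdealPowers.
Variable T : comNzRingType.
Implicit Types (I J L S : T -> Prop).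

Lemma ideal_gen_mem S x : S x -> ideal_gen S x.
Proof.
by move=> Sx; exists 1%N, (fun=> 1), (fun=> x); split=> //; rewrite big_ord1 mul1r.
Qed.

Lemma is_ideal_gen S : is_ideal (ideal_gen S).
Proof.
split=> [|_ _ [m [c [s [Ss ->]]]] [m' [c' [s' [Ss' ->]]]]
         |a _ [m [c [s [Ss ->]]]]].
- by exists 0%N, (fun=> 0), (fun=> 0); split; [case | rewrite big_ord0].
- exists (m + m')%N,
    (fun j => match split j with inl i => c i | inr i => c' i end),
    (fun j => match split j with inl i => s i | inr i => s' i end).
  split=> [j|]; first by case: (split j).
  rewrite big_split_ord /=; congr (_ + _); apply: eq_bigr => i _.
    by rewrite (unsplitK (inl i)).
  by rewrite (unsplitK (inr i)).
- exists m, (fun j => a * c j), s; split=> //.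
  by rewrite mulr_sumr; apply: eq_bigr => j _; rewrite mulrA.
Qed.

Lemma is_ideal_sum L (J : Type) (r : seq J) (P : pred J) (F : J -> T) :
  is_ideal L -> (forall j, P j -> L (F j)) -> L (\sum_(j <- r | P j) F j).
Proof. by move=> [L0 LD _] LF; elim/big_ind: _. Qed.

Lemma ideal_gen_min S L : is_ideal L -> incl S L -> incl (ideal_gen S) L.
Proof.
move=> idL SL _ [m [c [s [Ss ->]]]]; apply: is_ideal_sum => // j _.
by case: idL => _ _; apply; apply: SL.
Qed.

Lemma is_ideal_colon L z : is_ideal L -> is_ideal (fun x => L (x * z)).
Proof.
move=> [L0 LD LM]; split=> [|x y Lx Ly|a x Lx].
- by rewrite mul0r.
- by rewrite mulrDl; apply: LD.
- by rewrite -mulrA; apply: LM.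
Qed.

Lemma ideal_mul_min I J L : is_ideal L ->
  (forall x y, I x -> J y -> L (x * y)) -> incl (ideal_mul I J) L.
Proof.
by move=> idL IJL; apply: ideal_gen_min => // _ [x [y [Ix Jy ->]]]; apply: IJL.
Qed.

Lemma ideal_mul_mem I J x y : I x -> J y -> ideal_mul I J (x * y).
Proof. by move=> Ix Jy; apply: ideal_gen_mem; exists x, y. Qed.

Lemma is_ideal_pow I k : is_ideal (ideal_pow I k).
Proof. by case: k => [|k]; [split | apply: is_ideal_gen]. Qed.

Lemma ideal_pow1 I x : I x -> ideal_pow I 1 x.
Proof. by move=> Ix; rewrite -[x]mulr1; apply: ideal_mul_mem. Qed.

Lemma ideal_powD I i j x y :
  ideal_pow I i x -> ideal_pow I j y -> ideal_pow I (i + j) (x * y).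
Proof.
elim: i x => [|i IHi] x Ix Iy.
  by case: (is_ideal_pow I (0 + j)) => _ _; apply.
move: x Ix; apply: ideal_mul_min => [|x z Ix Iz].
  exact/is_ideal_colon/is_ideal_pow.
by rewrite -mulrA; apply: ideal_mul_mem => //; apply: IHi.
Qed.

Lemma ideal_powX I x m : I x -> ideal_pow I m (x ^+ m).
Proof.
by move=> Ix; elim: m => // m IHm; rewrite exprS; apply: ideal_mul_mem.
Qed.

Lemma ideal_pow_le I i j : (i <= j)%N -> incl (ideal_pow I j) (ideal_pow I i).
Proof.
move=> le_ij; rewrite -(subnK le_ij); elim: (j - i)%N => // d IHd.
rewrite addSn; apply: ideal_mul_min => [|x y _ /IHd]; first exact: is_ideal_pow.
by case: (is_ideal_pow I i) => _ _; apply.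
Qed.

Lemma ideal_pow_prod I (J : Type) (r : seq J) (P : pred J) (m : J -> nat)
    (F : J -> T) :
  (forall j, P j -> ideal_pow I (m j) (F j)) ->
  ideal_pow I (\sum_(j <- r | P j) m j)%N (\prod_(j <- r | P j) F j).
Proof.
move=> IF; apply: (big_ind2 (fun d x => ideal_pow I d x)) => // *.
exact: ideal_powD.
Qed.

Lemma ideal_pow_split I i j :
  incl (ideal_pow I (i + j)) (ideal_mul (ideal_pow I i) (ideal_pow I j)).
Proof.
elim: i => [|i IHi] x Ix; first by rewrite -[x]mul1r; apply: ideal_mul_mem.
move: x Ix; apply: ideal_mul_min => [|x y Ix /IHi Iy]; first exact: is_ideal_gen.
(* The elements z with x * z in the product form an ideal, so y may be taken to
   be a product u * w. *)
have idL := is_ideal_gen (fun z => exists u w,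
  [/\ ideal_pow I i.+1 u, ideal_pow I j w & z = u * w]).
rewrite mulrC; move: y Iy; apply: ideal_mul_min => [|u w Iu Iw].
  exact: is_ideal_colon.
by rewrite mulrC mulrA; apply: ideal_mul_mem => //; apply: ideal_mul_mem.
Qed.

(** A product of b N factors is regrouped into N blocks of b factors. *)
Lemma ideal_pow_pow I b N :
  incl (ideal_pow I (b * N)) (ideal_pow (ideal_pow I b) N).
Proof.
elim: N => // N IHN x; rewrite mulnS => /ideal_pow_split; move: x.
apply: ideal_mul_min => [|x y Ix /IHN]; first exact: is_ideal_pow.
exact: ideal_mul_mem.
Qed.

(** The power itself, as the only nonzero coefficient, is an equation of
    integral dependence. *)
Lemma integral_closure_pow J x N :
  (0 < N)%N -> ideal_pow J N (x ^+ N) -> integral_closure J x.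
Proof.
move=> N_gt0 JxN; exists N, (fun j => if j == N then - x ^+ N else 0).
split=> // [j _|].
  case: eqP => [->|_]; last by case: (is_ideal_pow J j).
  by rewrite -mulN1r; case: (is_ideal_pow J N) => _ _; apply.
rewrite big_nat_recr //= eqxx subnn expr0 mulr1 big_nat big1 ?add0r ?subrr //.
by move=> j /andP[_ ltjN]; rewrite ltn_eqF // mul0r.
Qed.

End IdealPowers.

Lemma ideal_pow_morph (T U : comNzRingType) (f : {rmorphism T -> U})
    (I : T -> Prop) (J : U -> Prop) k x :
  (forall y, I y -> J (f y)) -> ideal_pow I k x -> ideal_pow J k (f x).
Proof.
move=> IJ; elim: k x => // k IHk; apply: ideal_mul_min => [|x y Ix Iy].
  case: (is_ideal_pow J k.+1) => J0 JD JM; split=> [|u w Ju Jw|u w Jw].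
  - by rewrite rmorph0.
  - by rewrite rmorphD; apply: JD.
  - by rewrite rmorphM; apply: JM.
by rewrite rmorphM; apply: ideal_mul_mem; [apply: IJ | apply: IHk].
Qed.

(** * Linear inequalities over an ordered field *)

Section Farkas.
Variables (F : realFieldType) (V : lmodType F) (J : eqType).

Definition lin_form (f : V -> F) :=
  forall (k : F) x y, f (k *: x + y) = k * f x + f y.

(** Bartl's induction on the number of inequalities, which needs no finiteness
    of dimension. If the form a j0 cannot be dropped, some z satisfies the other
    inequalities with c z > 0, hence a j0 z > 0. Projecting along z onto the
    kernel of a j0 eliminates a j0, and the combination found for the projected
    forms determines its coefficient, which z makes nonnegative. *)
Lemma farkas (r : seq J) (a : J -> V -> F) (c : V -> F) :
  uniq r -> (forall j, lin_form (a j)) -> lin_form c ->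
  (forall x, (forall j, j \in r -> a j x <= 0) -> c x <= 0) ->
  exists l : J -> F, (forall j, 0 <= l j) /\
    (forall x, c x = \sum_(j <- r) l j * a j x).
Proof.
elim: r a c => [|j0 r IHr] a c /=.
  move=> _ _ lc c_le0; exists (fun=> 0); split=> // x; rewrite big_nil.
  have cN y : c (- y) = - c y.
    have c0 : c 0 = 0.
      by have := lc 1 0 0; rewrite scaler0 addr0 mul1r => E; lra.
    by have := lc (-1) y 0; rewrite scaleN1r addr0 c0 addr0 mulN1r.
  have := c_le0 x; have := c_le0 (- x); rewrite cN => H1 H2.
  by apply/eqP; rewrite eq_le H2 // -oppr_le0 H1.
move=> /andP[j0r uniq_r] la lc imp.
have [imp_r|] := pselect (forall x, (forall j, j \in r -> a j x <= 0) -> c x <= 0).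
  have [l [l_ge0 lE]] := IHr a c uniq_r la lc imp_r.
  exists (fun j => if j == j0 then 0 else l j); split=> [j|x].
    by case: ifP.
  rewrite big_cons eqxx mul0r add0r lE; apply: eq_big_seq => j jr.
  by case: eqP => // E; rewrite -E jr in j0r.
move=> /existsNP[z /not_implyP[z_le0 /negP]]; rewrite -ltNge => cz_gt0.
have a0z_gt0 : 0 < a j0 z.
  rewrite ltNge; apply/negP => a0z; suff: c z <= 0 by rewrite leNgt cz_gt0.
  by apply: imp => j; rewrite inE => /orP[/eqP->|/z_le0].
pose a' j x := a j x - a j z / a j0 z * a j0 x.
pose c' x := c x - c z / a j0 z * a j0 x.
have l' f : lin_form f -> lin_form (fun x => f x - f z / a j0 z * a j0 x).
  by move=> lf k x y; rewrite lf la; ring.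
have [|l [l_ge0 lE]] := IHr a' c' uniq_r (fun j => l' _ (la j)) (l' _ lc).
  (* a' j and c' are a j and c composed with the projection along z onto the
     kernel of a j0. *)
  move=> x x_le0.
  have projE f : lin_form f ->
      f (- (a j0 x / a j0 z) *: z + x) = f x - f z / a j0 z * a j0 x.
    by move=> ->; ring.
  rewrite /c' -projE //; apply: imp => j; rewrite inE projE //.
  case/orP=> [/eqP->|/x_le0 //].
  by rewrite divff ?gt_eqF // mul1r subrr.
exists (fun j => if j == j0 then (c z - \sum_(i <- r) l i * a i z) / a j0 z
                 else l j); split=> [j|x].
  case: ifP => // _; apply: divr_ge0; last exact: ltW.
  rewrite subr_ge0; apply: le_trans (ltW cz_gt0).
  rewrite big_seq; apply: sumr_le0 => i ir.
  by rewrite mulr_ge0_le0 // z_le0.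
rewrite big_cons eqxx.
transitivity (c' x + c z / a j0 z * a j0 x); first by rewrite subrK.
rewrite lE /a' (eq_bigr (fun j => l j * a j x - l j * a j z * (a j0 x / a j0 z)));
  last by move=> j _; ring.
rewrite sumrB -mulr_suml.
rewrite [X in _ = _ + X](eq_big_seq (fun j => l j * a j x)); first by ring.
by move=> j jr; case: eqP => // E; rewrite -E jr in j0r.
Qed.

End Farkas.

(** * Vertices of polyhedra *)

Section Vertices.
Variables (R : realType) (n : nat) (T : finType).
Variables (u : T -> 'cV[R]_n) (b : T -> R) (w : 'cV[R]_n).
Implicit Types x y d : 'rV[R]_n.

Local Notation dot x c := ((x *m c) 0 0).
Local Notation P := (fun x => forall t, b t <= dot x (u t)).

Lemma dotDl x y (c : 'cV[R]_n) : dot (x + y) c = dot x c + dot y c.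
Proof. by rewrite mulmxDl mxE. Qed.

Lemma dotZl k x (c : 'cV[R]_n) : dot (k *: x) c = k * dot x c.
Proof. by rewrite -scalemxAl mxE. Qed.

Lemma dotNl x (c : 'cV[R]_n) : dot (- x) c = - dot x c.
Proof. by rewrite mulNmx mxE. Qed.

Lemma dot_sumr x (A : pred T) :
  dot x (\sum_(t | A t) u t) = \sum_(t | A t) dot x (u t).
Proof. by rewrite mulmx_sumr summxE. Qed.

(** The sum of the tight constraints is a functional exposing x: a point of the
    polyhedron attains the same value only if all of them are tight there. *)
Lemma vertex_of_tight x : P x ->
  (forall d, (forall t, dot x (u t) = b t -> dot d (u t) = 0) -> d = 0) ->
  is_vertex P x.
Proof.
move=> Px tight0; split=> //.
exists (\sum_(t | dot x (u t) == b t) u t) => y Py y_neq_x.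
rewrite !dot_sumr lt_neqAle; apply/andP; split; last first.
  by apply: ler_sum => t /eqP->.
rewrite eq_sym -subr_eq0 -sumrB psumr_neq0 => [|t /eqP->]; last first.
  by rewrite subr_ge0.
apply: contraT => /hasPn all0; case/eqP: y_neq_x; apply/subr0_eq/tight0 => t xt.
rewrite dotDl dotNl; apply/eqP; rewrite eq_le.
have := all0 t (mem_index_enum t); rewrite xt eqxx /= -leNgt => -> /=.
by rewrite subr_ge0 Py.
Qed.

Hypothesis w_bounded : forall d, (forall t, 0 <= dot d (u t)) -> 0 <= dot d w.
Hypothesis pointed : forall d, (forall t, dot d (u t) = 0) -> d = 0.

(** Walking along d, a line on which the tight constraints stay tight and the
    objective does not grow, the first constraint hit becomes tight. *)
Lemma tighten x d : P x ->
  (forall t, dot x (u t) = b t -> dot d (u t) = 0) ->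
  dot d w <= 0 -> (exists t, dot d (u t) < 0) ->
  exists y, [/\ P y, dot y w <= dot x w &
    [set t | dot y (u t) != b t] \proper [set t | dot x (u t) != b t]].
Proof.
move=> Px tight0 dw [t1 dt1].
pose s t := (dot x (u t) - b t) / - dot d (u t).
have [t0 dt0 s_min] := arg_minP s (i0 := t1) (P := fun t => dot d (u t) < 0) dt1.
have s0_ge0 : 0 <= s t0.
  by rewrite divr_ge0 ?subr_ge0 ?oppr_ge0 // ltW.
have yE t : dot (x + s t0 *: d) (u t) = dot x (u t) + s t0 * dot d (u t).
  by rewrite dotDl dotZl.
have yt0 : dot (x + s t0 *: d) (u t0) = b t0.
  by rewrite yE /s; field; rewrite lt_eqF.
exists (x + s t0 *: d); split.
- move=> t; rewrite yE; have [dt|dt] := leP 0 (dot d (u t)).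
    by rewrite -[b t]addr0 lerD // mulr_ge0.
  have := s_min t dt; rewrite {2}/s ler_pdivlMr ?oppr_gt0 // => H.
  by lra.
- by rewrite dotDl dotZl -[leRHS]addr0 lerD2l mulr_ge0_le0.
- apply/properP; split.
    apply/subsetP => t; rewrite !inE yE; apply: contraNN => /eqP xt.
    by rewrite tight0 // mulr0 addr0 xt.
  exists t0; rewrite inE ?yt0 ?eqxx //.
  by apply: contraTN dt0 => /eqP xt0; rewrite tight0 // ltxx.
Qed.

(** A point at which the tight constraints vanish together along some line is
    moved by [tighten] in one of the two directions of that line: pointedness
    and the bound on w ensure that one direction meets a new constraint without
    increasing w. The number of slack constraints decreases, and
    [vertex_of_tight] applies when no such line is left. *)
Lemma vertex_exists x : P x -> exists y, is_vertex P y /\ dot y w <= dot x w.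
Proof.
have [m] := ubnP #|[set t | dot x (u t) != b t]|.
elim: m x => // m IHm x; rewrite ltnS => lem Px.
have [allD|] := pselect
  (forall d, (forall t, dot x (u t) = b t -> dot d (u t) = 0) -> d = 0).
  by exists x; split=> //; apply: vertex_of_tight.
move=> /existsNP[d /not_implyP[tight0 d_neq0]].
have tightN t : dot x (u t) = b t -> dot (- d) (u t) = 0.
  by move=> /tight0 dt0; rewrite dotNl dt0 oppr0.
have neg_exists d' : ~ (exists t, dot d' (u t) < 0) -> forall t, 0 <= dot d' (u t).
  by move=> nex t; rewrite leNgt; apply/negP => dt; apply: nex; exists t.
have [d1 [tight1 d1w neg1]] : exists d1,
    [/\ forall t, dot x (u t) = b t -> dot d1 (u t) = 0, dot d1 w <= 0 &
        exists t, dot d1 (u t) < 0].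
  have [neg|/neg_exists nneg] := pselect (exists t, dot d (u t) < 0); last first.
    exists (- d); split=> //; first by rewrite dotNl oppr_le0 w_bounded.
    apply: contrapT => /neg_exists nnegN; apply: d_neq0; apply: pointed => t.
    by apply/eqP; rewrite eq_le nneg -oppr_ge0 -dotNl nnegN.
  have [dw|dw] := leP (dot d w) 0; first by exists d.
  exists (- d); split=> //; first by rewrite dotNl oppr_le0 ltW.
  apply: contrapT => /neg_exists /w_bounded.
  by rewrite dotNl oppr_ge0 leNgt dw.
have [y [Py yw y_proper]] := tighten Px tight1 d1w neg1.
have [z [Vz zw]] := IHm y (leq_trans (proper_card y_proper) lem) Py.
by exists z; split=> //; apply: le_trans yw.
Qed.

End Vertices.

(** * Cover inequalities and packings of edges *)

Section CoverInequalities.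
Variables (R : realType) (n q : nat) (v : 'I_q -> 'X_{1..n}).
Hypothesis a1 :
  integral_polyhedron (set_covering_polyhedron (exponent_matrix R v)).

Definition covers_ge (a : 'X_{1..n}) (b : nat) :=
  forall C, vertex_cover (clutter_of v) C -> (b <= \sum_(i in C) a i)%N.

Lemma vertex_coverP (C : {set 'I_n}) :
  reflect (forall k, exists2 i, i \in C & v k i != 0%N)
          (vertex_cover (clutter_of v) C).
Proof.
apply: (iffP forall_inP) => [cov k|cov _ /imsetP[k _ ->]].
  have vk : mnm_supp (v k) \in clutter_of v by apply/imsetP; exists k.
  have /set0Pn[i] := cov _ vk.
  by rewrite !inE => /andP[iC vki]; exists i.
have [i iC vki] := cov k.
by apply/set0Pn; exists i; rewrite !inE iC.
Qed.

(** An integral point of the covering polyhedron dominates the indicator of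
    its support, and that support is a vertex cover. *)
Lemma covers_ge_integral_point a b (x : 'rV[R]_n) : covers_ge a b ->
  set_covering_polyhedron (exponent_matrix R v) x ->
  (forall i, x 0 i \is a Num.int) ->
  b%:R <= \sum_i x 0 i * (a i)%:R.
Proof.
move=> ab [x_ge0 x_ge1] x_int.
have cov : vertex_cover (clutter_of v) [set i | x 0 i != 0].
  apply/vertex_coverP => k; apply: contrapT => nex.
  have := x_ge1 k; rewrite mxE big1 ?ler10 // => i _; rewrite mxE.
  have [->|xi] := eqVneq (x 0 i) 0; first by rewrite mul0r.
  have [->|vki] := eqVneq (v k i) 0%N; first by rewrite mulr0.
  by case: nex; exists i => //; rewrite inE.
apply: (@le_trans _ _ (\sum_(i in [set i | x 0 i != 0]) (a i)%:R)).
  by rewrite -natr_sum ler_nat ab.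
rewrite [leRHS](bigID (mem [set i | x 0 i != 0])) /=.
rewrite -[leLHS]addr0 lerD //; last first.
  by apply: sumr_ge0 => i _; rewrite mulr_ge0.
apply: ler_sum => i; rewrite inE => xi; rewrite -[leLHS]mul1r.
apply: ler_wpM2r => //; move: xi (x_ge0 i); have /intrP[z ->] := x_int i.
by rewrite intr_eq0 ler0z ler1z; case: z => [[|z]|].
Qed.

(** A linear form with nonnegative coefficients is minimized at a vertex of the
    polyhedron, and vertices are integral points. *)
Lemma covers_ge_polyhedron a b (x : 'rV[R]_n) : covers_ge a b ->
  set_covering_polyhedron (exponent_matrix R v) x ->
  b%:R <= \sum_i x 0 i * (a i)%:R.
Proof.
move=> ab [x_ge0 x_ge1].
pose u (t : 'I_n + 'I_q) : 'cV[R]_n :=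
  match t with inl i => delta_mx i 0 | inr k => col k (exponent_matrix R v) end.
pose rhs (t : 'I_n + 'I_q) : R := if t is inl _ then 0 else 1.
pose w : 'cV[R]_n := \col_i (a i)%:R.
have uE (y : 'rV[R]_n) t : (y *m u t) 0 0 =
    match t with inl i => y 0 i | inr k => (y *m exponent_matrix R v) 0 k end.
  case: t => [i|k] /=; last by rewrite colE mulmxA -colE mxE.
  by rewrite -colE mxE.
have wE (y : 'rV[R]_n) : (y *m w) 0 0 = \sum_i y 0 i * (a i)%:R.
  by rewrite mxE; apply: eq_bigr => i _; rewrite mxE.
have w_ge0 (d : 'rV[R]_n) : (forall t, 0 <= (d *m u t) 0 0) -> 0 <= (d *m w) 0 0.
  move=> d_ge0; rewrite wE; apply: sumr_ge0 => i _; rewrite mulr_ge0 //.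
  by have := d_ge0 (inl i); rewrite uE.
have u_pointed (d : 'rV[R]_n) : (forall t, (d *m u t) 0 0 = 0) -> d = 0.
  by move=> d0; apply/rowP => i; have := d0 (inl i); rewrite uE mxE.
have Px t : rhs t <= (x *m u t) 0 0 by rewrite uE; case: t.
have [y [Vy yx]] := vertex_exists w_ge0 u_pointed Px.
move: yx; rewrite !wE; apply: le_trans.
case: Vy => Py [c c_min].
have Qy z : (forall t, rhs t <= (z *m u t) 0 0) <->
    set_covering_polyhedron (exponent_matrix R v) z.
  split=> [Pz|[z_ge0 z_ge1] [i|k]]; rewrite ?uE //.
  by split=> [i|k]; [have := Pz (inl i) | have := Pz (inr k)]; rewrite uE.
apply: covers_ge_integral_point (ab) (proj1 (Qy y) Py) _.
by apply: a1; split; [apply/Qy | exists c => z /Qy; apply: c_min].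
Qed.

(** The denominators of a real packing could not be cleared, so duality is
    applied over the rationals; only the integrality hypothesis is real. *)
Lemma covers_ge_rat a b (y : 'I_n -> rat) : covers_ge a b ->
  (forall i, 0 <= y i) -> (forall k, 1 <= \sum_i y i * (v k i)%:R) ->
  b%:R <= \sum_i y i * (a i)%:R.
Proof.
move=> ab y_ge0 y_ge1; rewrite -(ler_rat R) rmorph_nat rmorph_sum /=.
have -> : \sum_i ratr (y i * (a i)%:R) =
    \sum_i (\row_j ratr (y j) : 'rV[R]_n) 0 i * (a i)%:R.
  by apply: eq_bigr => i _; rewrite rmorphM rmorph_nat mxE.
apply: covers_ge_polyhedron => //; split=> [i|k]; first by rewrite mxE ler0q.
have := y_ge1 k; rewrite -(ler_rat R) rmorph1 rmorph_sum /= mxE.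
by congr (_ <= _); apply: eq_bigr => i _; rewrite !mxE rmorphM rmorph_nat.
Qed.

(** The dual linear program. The second component of V homogenizes the
    covering inequalities: a point (y, s) with s > 0 stands for y / s. *)
Lemma rat_packing a b : covers_ge a b ->
  exists l : 'I_q -> rat, [/\ forall k, 0 <= l k,
    forall i, \sum_k l k * (v k i)%:R <= (a i)%:R & b%:R <= \sum_k l k].
Proof.
move=> ab; pose V := ('rV[rat]_n * rat^o)%type.
pose dotv (y : V) (c : 'X_{1..n}) := \sum_i y.1 0 i * (c i)%:R.
have dotvE c (k : rat) (x y : V) :
    dotv (k *: x + y) c = k * dotv x c + dotv y c.
  rewrite /dotv mulr_sumr -big_split; apply: eq_bigr => i _ /=.
  by rewrite !mxE; ring.
pose f (j : 'I_n + 'I_q + 'I_1) (x : V) : rat := match j with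
  | inr _ => - x.2 | inl (inl i) => - x.1 0 i | inl (inr k) => x.2 - dotv x (v k)
  end.
pose c (x : V) : rat := x.2 * b%:R - dotv x a.
have f_lin j : lin_form (f j).
  case: j => [[i|k]|j] t x y; rewrite /f ?dotvE /= ?mxE /GRing.scale /=; ring.
have c_lin : lin_form c.
  by move=> t x y; rewrite /c dotvE /= /GRing.scale /=; ring.
have [|l [l_ge0 lE]] :=
    farkas (index_enum_uniq ('I_n + 'I_q + 'I_1)%type) f_lin c_lin.
  move=> x x_le0; have fx j : f j x <= 0 by apply: (x_le0 j); apply: mem_index_enum.
  have x1_ge0 i : 0 <= x.1 0 i by have := fx (inl (inl i)); rewrite /= oppr_le0.
  have := fx (inr 0); rewrite /= oppr_le0 le_eqVlt => /orP[/eqP x2|x2_gt0].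
    rewrite /c -x2 mul0r sub0r oppr_le0; apply: sumr_ge0 => i _.
    exact: mulr_ge0.
  rewrite /c subr_le0 mulrC -ler_pdivlMr // /dotv mulr_suml.
  rewrite (eq_bigr (fun i => x.1 0 i / x.2 * (a i)%:R)) => [|i _]; last first.
    by rewrite mulrAC.
  apply: covers_ge_rat => // [i|k]; first by rewrite divr_ge0 // ltW.
  rewrite (eq_bigr (fun i => x.1 0 i * (v k i)%:R / x.2)) => [|i _]; last first.
    by rewrite mulrAC.
  rewrite -mulr_suml ler_pdivlMr // mul1r -subr_le0.
  exact: fx (inl (inr k)).
have {}lE x : c x = l (inr 0) * f (inr 0) x + (\sum_i l (inl (inl i)) * f (inl (inl i)) x
    + \sum_k l (inl (inr k)) * f (inl (inr k)) x).
  by rewrite lE !big_sumType big_ord1 /= addrC.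
exists (fun k => l (inl (inr k))); split=> // [i|].
(* The identity of linear forms is evaluated at (e_i, 0). *)
- have dotvi (m : 'X_{1..n}) : dotv (delta_mx 0 i, 0) m = (m i)%:R.
    rewrite /dotv (bigD1 i) //= big1 => [|j /negPf j_neq].
      by rewrite mxE !eqxx mul1r addr0.
    by rewrite mxE j_neq andbF mul0r.
  have := lE (delta_mx 0 i, 0).
  rewrite /c /f /= mul0r dotvi oppr0 mulr0 !add0r.
  rewrite [X in _ = _ + X -> _](eq_bigr
    (fun k => - (l (inl (inr k)) * (v k i)%:R))) => [|k _]; last first.
    by rewrite dotvi sub0r mulrN.
  rewrite sumrN -lerN2 => ->.
  rewrite -[leRHS]add0r lerD2r; apply: sumr_le0 => j _.
  by rewrite mulr_ge0_le0 // oppr_le0 mxE ler0n.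
(* The identity of linear forms is evaluated at (0, 1). *)
- have dotv0 (m : 'X_{1..n}) : dotv (0, 1) m = 0.
    by rewrite /dotv big1 // => i _; rewrite mxE mul0r.
  have := lE (0, 1); rewrite /c /f /= mul1r dotv0 subr0 => ->.
  rewrite [X in _ + (X + _)]big1 => [|i _]; last by rewrite mxE oppr0 mulr0.
  rewrite add0r (eq_bigr (fun k => l (inl (inr k)))) => [|k _]; last first.
    by rewrite dotv0 subr0 mulr1.
  by rewrite -[leRHS]add0r lerD2r mulrN1 oppr_le0.
Qed.

Lemma nat_packing a b : covers_ge a b ->
  exists N (l : 'I_q -> nat), [/\ (0 < N)%N,
    forall i, (\sum_k l k * v k i <= a i * N)%N & (b * N <= \sum_k l k)%N].
Proof.
move=> /rat_packing[l [l_ge0 la bl]].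
pose N := (\prod_k `|denq (l k)|)%N.
have N_gt0 : (0 < N)%N by rewrite prodn_gt0 // => k; rewrite absz_gt0 denq_neq0.
have lN k : exists m : nat, l k * N%:R = m%:R.
  exists (`|numq (l k)| * \prod_(k' | k' != k) `|denq (l k')|)%N.
  rewrite /N (bigD1 k) //= !natrM mulrA; congr (_ * _).
  by rewrite !natr_absz normr_denq ger0_norm ?numq_ge0 // numqE.
have {lN} [m mE] : exists m : 'I_q -> nat, forall k, l k * N%:R = (m k)%:R.
  by have [m] := choice lN; exists m.
have N0 : 0 < N%:R :> rat by rewrite ltr0n.
exists N, m; split=> // [i|].
- rewrite -(ler_nat rat) natrM natr_sum.
  apply: le_trans (ler_wpM2r (ltW N0) (la i)); rewrite mulr_suml.
  by apply: ler_sum => k _; rewrite natrM -mE mulrAC.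
- rewrite -(ler_nat rat) natrM natr_sum -(eq_bigr _ (fun k _ => mE k)).
  by rewrite -mulr_suml ler_pM2r.
Qed.

End CoverInequalities.

(** * Covers and matchings in clutters *)

Section Clutter.
Variables (V : finType) (E : {set {set V}}).

Lemma minimal_cover_sub C : vertex_cover E C ->
  exists A, minimal_vertex_cover E A /\ A \subset C.
Proof. by move=> /minset_exists[A minA AC]; exists A. Qed.

(** If x lies on an edge e and no other edge is contained in e, then the
    complement of e together with x is a cover, and meets e in x only. *)
Lemma mem_minimal_cover e x : e \in E -> x \in e ->
  (forall e', e' \in E -> e' \subset e -> e' = e) ->
  exists2 C, minimal_vertex_cover E C & x \in C.
Proof.
move=> eE xe e_min.
have [|A [minA Asub]] := @minimal_cover_sub (x |: ~: e).
  apply/forall_inP => e' e'E; apply/set0Pn; apply: contrapT => nex.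
  have e'e : e' = e.
    apply: e_min => //; apply/subsetP => y ye'; apply: contrapT => /negP ye.
    by apply: nex; exists y; rewrite !inE ye orbT.
  by apply: nex; exists x; rewrite !inE eqxx e'e.
exists A => //.
have /forall_inP/(_ e eE)/set0Pn[y] := minsetp minA.
rewrite inE => /andP[yA ye]; move: (subsetP Asub y yA).
by rewrite !inE ye orbF => /eqP <-.
Qed.

(** The edges of a matching are met by the cover in distinct vertices. *)
Lemma matching_le_cover (M : {set {set V}}) C :
  M \subset E -> trivIset M -> vertex_cover E C ->
  (#|M| <= #|C :&: cover M|)%N.
Proof.
move=> ME trivM covC.
rewrite -[leqLHS]sum1_card -[leqRHS]sum1_card.
rewrite (eq_bigl (fun x => (x \in cover M) && (x \in C))); last first.
  by move=> x; rewrite inE andbC.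
rewrite big_trivIset_cond //=; apply: leq_sum => e eM.
have /forall_inP/(_ e (subsetP ME e eM))/set0Pn[x] := covC.
by rewrite inE => /andP[xC xe]; rewrite (bigD1 x) ?xe.
Qed.

Lemma unmixed_le_alpha0 C : unmixed E -> minimal_vertex_cover E C ->
  (#|C| <= alpha0 E)%N.
Proof.
move=> unm minC; rewrite /alpha0; elim/big_rec: _ => [|D d covD le_d].
  exact: max_card.
rewrite leq_min le_d andbT.
have [A [minA AD]] := minimal_cover_sub covD.
by rewrite (unm _ _ minC minA) subset_leq_card.
Qed.

(** A maximum matching has as many edges as a minimal cover C has vertices, so
    C must be contained in the union of the matching. *)
Lemma konig_perfect_matching : unmixed E -> konig E ->
  (forall x, exists2 C, minimal_vertex_cover E C & x \in C) ->
  exists M : {set {set V}}, [/\ M \subset E, trivIset M, cover M = setT &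
    forall C, minimal_vertex_cover E C -> #|C| = #|M|].
Proof.
move=> unm kon allC.
have [|M /andP[ME trivM] betaM] := @eq_bigmax_cond _
  [pred M : {set {set V}} | (M \subset E) && trivIset M] (fun M => #|M|).
  apply/card_gt0P; exists set0; rewrite inE sub0set; apply/trivIsetP => A B.
  by rewrite inE.
have leCM C : minimal_vertex_cover E C -> (#|C| <= #|M|)%N.
  by move=> minC; rewrite -betaM -[leqRHS]kon; apply: unmixed_le_alpha0.
have leMC C : minimal_vertex_cover E C -> (#|M| <= #|C :&: cover M|)%N.
  by move=> /minsetp covC; apply: matching_le_cover.
exists M; split=> // [|C minC].
- apply/setP => x; rewrite inE; have [C minC] := allC x; apply: subsetP.
  apply/setIidPl/eqP; rewrite eqEcard subsetIl.
  exact: leq_trans (leCM C minC) (leMC C minC).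
- apply/eqP; rewrite eqn_leq leCM //=; apply: leq_trans (leMC C minC) _.
  exact/subset_leq_card/subsetIl.
Qed.

End Clutter.

(** * Edge monomials *)

Section MonomialPowers.
Variables (K : fieldType) (R : realType) (n q : nat) (v : 'I_q -> 'X_{1..n}).
Variable I : {mpoly K[n]} -> Prop.
Hypothesis a1 :
  integral_polyhedron (set_covering_polyhedron (exponent_matrix R v)).
Hypothesis I_gen :
  minimally_generates (fun f : {mpoly K[n]} => exists k, f = 'X_[v k]) I.

Lemma edge_ideal_mem k : I 'X_[v k].
Proof. by case: I_gen => IE _; apply/IE/ideal_gen_mem; exists k. Qed.

Definition drop_exp i (m : 'X_{1..n}) : 'X_{1..n.-1} :=
  [multinom m (lift i j) | j < n.-1].

Lemma comp_drop_exp i (m : 'X_{1..n}) : m i = 0%N ->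
  'X_[drop_exp i m] \mPo [tuple 'X_(lift i j) | j < n.-1] = 'X_[m] :> {mpoly K[n]}.
Proof.
move=> mi; rewrite comp_mpolyX mpolyXE_id (bigD1_ord i) //= mi expr0 mul1r.
by apply: eq_bigr => j _; rewrite tnth_mktuple mnmE.
Qed.

(** By [nat_packing] the N-th power of x^a is a multiple of a product of at
    least b N edge monomials; these avoid x_i because a i = 0, so that x^a, read in the
    ring without x_i, is integral over I_i^b. *)
Lemma mem_pow_zero_coord (a : 'X_{1..n}) b i : a i = 0%N ->
  normal_ideal (elim_var I i) -> covers_ge v a b -> ideal_pow I b 'X_[a].
Proof.
move=> ai normI; case: b => // b ab.
rewrite -(comp_drop_exp ai).
apply: (@ideal_pow_morph _ _
  (comp_mpoly [tuple 'X_(lift i j) | j < n.-1]) (elim_var I i)) => //.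
apply/normI => //.
have [N [l [N_gt0 la bl]]] := nat_packing a1 ab.
apply: (@integral_closure_pow _ _ _ N) => //; apply: ideal_pow_pow.
apply: (ideal_pow_le bl).
pose s := (\sum_k drop_exp i (v k) *+ l k)%MM.
have s_le : (s <= drop_exp i a *+ N)%MM.
  apply/mnm_lepP => j; rewrite mnm_sumE mulmnE mnmE.
  apply: leq_trans (la (lift i j)); rewrite leq_eqVlt; apply/orP; left; apply/eqP.
  by apply: eq_bigr => k _; rewrite mulmnE mnmE mulnC.
rewrite mpolyXn -(submK s_le) mpolyXD.
case: (is_ideal_pow (elim_var I i) (\sum_k l k)%N) => _ _; apply.
rewrite (big_morph _ (@mpolyXD _ _) (@mpolyX0 _ _)).
apply: ideal_pow_prod => k _; rewrite -mpolyXn.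
have [->//|lk] := posnP (l k).
apply: ideal_powX; rewrite /elim_var comp_drop_exp; first exact: edge_ideal_mem.
have := la i; rewrite ai mul0n leqn0 sum_nat_eq0 => /forallP/(_ k).
by rewrite muln_eq0 => /orP[/eqP l0|/eqP //]; rewrite l0 in lk.
Qed.

Hypothesis v_inj : injective v.
Hypothesis v_squarefree : forall k i, (v k i <= 1)%N.

Lemma edge_exp k i : v k i = (i \in mnm_supp (v k)).
Proof. by rewrite inE; case: (v k i) (v_squarefree k i) => [|[]]. Qed.

(** Of two comparable edges, the larger one is a redundant generator. *)
Lemma edge_antichain k l :
  mnm_supp (v l) \subset mnm_supp (v k) -> l = k.
Proof.
move=> /subsetP lk; apply: contrapT => neq_lk; case: I_gen => IE Imin.
have le_lk : (v l <= v k)%MM.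
  by apply/mnm_lepP => i; rewrite !edge_exp; case: (boolP (i \in _)) => // /lk ->.
pose S' (f : {mpoly K[n]}) := exists l, l <> k /\ f = 'X_[v l].
have [|||k' [neq_k'k /(congr1 (@msupp _ _))]] := Imin S' _ _ 'X_[v k].
- by move=> _ [k' [_ ->]]; exists k'.
- move=> x /IE; move: x; apply: ideal_gen_min => [|_ [k' ->]].
    exact: is_ideal_gen.
  have [->|/eqP neq] := eqVneq k' k; last by apply: ideal_gen_mem; exists k'.
  rewrite -(submK le_lk) mpolyXD.
  case: (is_ideal_gen S') => _ _; apply.
  by apply: ideal_gen_mem; exists l.
- by exists k.
- by rewrite !msuppX => -[/v_inj eq_kk']; case: neq_k'k.
Qed.

End MonomialPowers.

(** * The cover algebra is normal *)

Section CoverAlgebra.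
Variables (K : fieldType) (n q : nat) (v : 'I_q -> 'X_{1..n}).
Implicit Types (a b m : 'X_{1..n}) (p : {mpoly K[n]}).
Implicit Types (f g h : {poly {mpoly K[n]}}).

Definition cover_ideal k p := forall m, m \in msupp p -> covers_ge v m k.

Definition cover_algebra f := forall k, cover_ideal k f`_k.

Lemma covers_geD a b i j :
  covers_ge v a i -> covers_ge v b j -> covers_ge v (a + b)%MM (i + j)%N.
Proof.
move=> ai bj C covC; rewrite (eq_bigr (fun x => a x + b x)%N) => [|x _].
  by rewrite big_split leq_add ?ai ?bj.
by rewrite mnmDE.
Qed.

Lemma cover_idealM i j p r :
  cover_ideal i p -> cover_ideal j r -> cover_ideal (i + j) (p * r).
Proof.
move=> pi rj m /msuppM_le/allpairsP[[a b] /= [am bm ->]].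
by apply: covers_geD; [apply: pi | apply: rj].
Qed.

Lemma is_ideal_cover k : is_ideal (cover_ideal k).
Proof.
split=> [m|x y xk yk m /msuppD_le|a x xk].
- by rewrite msupp0.
- by rewrite mem_cat => /orP[/xk|/yk].
- by rewrite -[k]add0n; apply: cover_idealM.
Qed.

Lemma cover_algebraD f g :
  cover_algebra f -> cover_algebra g -> cover_algebra (f + g).
Proof.
move=> Sf Sg k; rewrite coefD.
by case: (is_ideal_cover k) => _ + _; apply.
Qed.

Lemma cover_algebraM f g :
  cover_algebra f -> cover_algebra g -> cover_algebra (f * g).
Proof.
move=> Sf Sg k; rewrite coefM; apply: is_ideal_sum => [|j _].
  exact: is_ideal_cover.
rewrite -{1}(subnKC (_ : j <= k)%N); last by rewrite -ltnS.
exact: cover_idealM.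
Qed.

Lemma cover_algebraC p : cover_algebra p%:P.
Proof.
by move=> k m; rewrite coefC; case: k => [|k]; rewrite ?msupp0.
Qed.

Lemma cover_algebra_sum (J : Type) (r : seq J) (P : pred J)
    (F : J -> {poly {mpoly K[n]}}) :
  (forall j, P j -> cover_algebra (F j)) ->
  cover_algebra (\sum_(j <- r | P j) F j).
Proof.
move=> SF; elim/big_rec: _ => [|j f Pj Sf]; first exact: cover_algebraC.
by apply: cover_algebraD => //; apply: SF.
Qed.

Lemma cover_algebraX f k : cover_algebra f -> cover_algebra (f ^+ k).
Proof.
move=> Sf; elim: k => [|k IHk]; first exact: cover_algebraC.
by rewrite exprS; apply: cover_algebraM.
Qed.

Lemma cover_algebra_term c m k :
  covers_ge v m k -> cover_algebra ((c *: 'X_[m])%:P * 'X^k).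
Proof.
move=> mk j m'; rewrite coefCM coefXn; case: eqP => [->|_].
  by rewrite mulr1 => /msuppZ_le; rewrite msuppX inE => /eqP ->.
by rewrite mulr0 msupp0.
Qed.

Lemma leq_of_multiples x y d :
  (forall N, N * x <= d + N * y)%N -> (x <= y)%N.
Proof.
move=> le_xy; rewrite leqNgt; apply/negP => lt_yx.
by have := le_xy d.+1; nia.
Qed.

(** Each inequality defining the exponents of the cover algebra is linear, so
    it passes from d + N (a - b) for all N to the direction a - b. *)
Lemma covers_ge_direction a b d (x y z : nat) :
  (forall N, exists m r, [/\ covers_ge v m r,
     (d + a *+ N)%MM = (m + b *+ N)%MM & (z + N * x = r + N * y)%N]) ->
  [/\ (b <= a)%MM, (y <= x)%N & covers_ge v (a - b)%MM (x - y)].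
Proof.
move=> dir.
have le_ba : (b <= a)%MM.
  apply/mnm_lepP => i; apply: (@leq_of_multiples _ _ (d i)) => N.
  have [m [r [_ /mnmP/(_ i) E _]]] := dir N.
  by move: E; rewrite !mnmDE !mulmnE; nia.
have le_yx : (y <= x)%N.
  by apply: (@leq_of_multiples _ _ z) => N; have [m [r [_ _ E]]] := dir N; nia.
split=> // C covC.
have sumD : (\sum_(i in C) a i = \sum_(i in C) (a - b)%MM i + \sum_(i in C) b i)%N.
  by rewrite -big_split; apply: eq_bigr => i _; rewrite -{1}(submK le_ba) mnmDE.
suff : (x + \sum_(i in C) b i <= y + \sum_(i in C) a i)%N by lia.
apply: (@leq_of_multiples _ _ (\sum_(i in C) d i)) => N.
have [m [r [/(_ C covC) mr mE rE]]] := dir N.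
have : (\sum_(i in C) d i + N * \sum_(i in C) a i =
        \sum_(i in C) m i + N * \sum_(i in C) b i)%N.
  rewrite !big_distrr -!big_split; apply: eq_bigr => i _ /=.
  by have /mnmP/(_ i) := mE; rewrite !mnmDE !mulmnE ![(N * _)%N]mulnC.
nia.
Qed.

Lemma mlead_cancel (p r : {mpoly K[n]}) : mlead p = mlead r ->
  mleadc p = mleadc r -> p - r != 0 -> (mlead (p - r) < mlead p)%O.
Proof.
move=> eq_m eq_c; apply: contraR; rewrite -leNgt => le_p.
have E : mlead (p - r) = mlead p.
  apply/le_anti; rewrite le_p andbT; apply: le_trans (mleadB_le _ _) _.
  by rewrite -eq_m joinxx.
by rewrite -mleadc_eq0 E mcoeffB eq_c -eq_m subrr.
Qed.

(** d (f / g)^N lies in the cover algebra for all N: the fraction f / g is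
    almost integral, with the denominators cleared. *)
Definition almost_multiple d g f :=
  forall N, exists2 h, cover_algebra h & d * f ^+ N = h * g ^+ N.

(** Almost integral fractions with a given d are stable under translation by
    the algebra, by the binomial formula. *)
Lemma almost_multipleB d g f c : cover_algebra c ->
  almost_multiple d g f -> almost_multiple d g (f - c * g).
Proof.
move=> Sc /(_ _)/cid2-/all_sig2[h Sh hE] N.
exists (\sum_(i < N.+1) (((-1) ^+ i)%:P * h (N - i)%N * c ^+ i) *+ 'C(N, i)).
  apply: cover_algebra_sum => i _; rewrite -mulr_natl -polyC_natr.
  apply: cover_algebraM; first exact: cover_algebraC.
  apply: cover_algebraM; last exact: cover_algebraX.
  by apply: cover_algebraM; first exact: cover_algebraC.
rewrite exprBn mulr_sumr mulr_suml; apply: eq_bigr => i _.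
rewrite mulrnAr mulrnAl; congr (_ *+ _).
rewrite exprMn !mulrA [d * _]mulrC -[_ * d * _]mulrA hE.
have -> : g ^+ N = g ^+ (N - i) * g ^+ i.
  by rewrite -exprD subnK // -ltnS.
rewrite rmorphXn rmorphN1; ring.
Qed.

(** Division by leading terms, for the lexicographic order that compares the
    degree in t first: the leading exponent of f minus that of g satisfies the
    inequalities of the cover algebra. *)
Lemma cover_algebra_div d g f : d != 0 -> g != 0 ->
  almost_multiple d g f -> exists2 c, cover_algebra c & f = c * g.
Proof.
move=> d0 g0.
have [s] := ubnP (size f); elim: s f => // s IHs f; rewrite ltnS => le_fs.
move E : (lead_coef f) => p.
elim/mleadrect: p f le_fs E => p IHp f le_fs lead_f fm.
have [f0|f0] := eqVneq f 0.
  by exists 0; [exact: cover_algebraC | rewrite mul0r].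
have lc0 (x : {poly {mpoly K[n]}}) : x != 0 -> lead_coef x != 0.
  by rewrite lead_coef_eq0.
have size_gt0 (x : {poly {mpoly K[n]}}) : x != 0 -> (0 < size x)%N.
  by rewrite size_poly_gt0.
have [|le_gf le_sgf dir_ge] := @covers_ge_direction
  (mlead (lead_coef f)) (mlead (lead_coef g)) (mlead (lead_coef d))
  (size f).-1 (size g).-1 (size d).-1.
  move=> N; have [h Sh hE] := fm N.
  have h0 : h != 0.
    apply: contraTneq (mulf_neq0 d0 (expf_neq0 N f0)) => h0.
    by rewrite hE h0 mul0r eqxx.
  exists (mlead (lead_coef h)), (size h).-1; split.
  - exact/(Sh _)/mlead_supp/lc0.
  - have := congr1 (fun x => mlead (lead_coef x)) hE.
    by rewrite !lead_coefM !lead_coef_exp !mleadM ?mleadX ?expf_neq0 ?lc0.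
  - have := congr1 (fun x : {poly _} => (size x).-1) hE.
    rewrite !size_mul ?expf_neq0 // -[size (f ^+ N)]prednK ?size_gt0 ?expf_neq0 //.
    rewrite -[size (g ^+ N)]prednK ?size_gt0 ?expf_neq0 //.
    rewrite !size_exp !addnS /= ![(N * _)%N]mulnC.
    by rewrite -(prednK (size_gt0 d d0)) -(prednK (size_gt0 h h0)).
pose e := (mlead (lead_coef f) - mlead (lead_coef g))%MM.
pose c0 := mleadc (lead_coef f) / mleadc (lead_coef g).
pose c := (c0 *: 'X_[e])%:P * 'X^((size f).-1 - (size g).-1).
have Sc : cover_algebra c by apply: cover_algebra_term.
have c0_neq0 : c0 != 0 by rewrite mulf_neq0 ?invr_eq0 ?mleadc_eq0 ?lc0.
have e0 : c0 *: 'X_[e] != 0 :> {mpoly K[n]}.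
  by rewrite -mleadc_eq0 mleadcZE mleadXm mcoeffX eqxx mulr1.
have c_neq0 : c != 0 by rewrite mulf_neq0 ?polyC_eq0 ?monic_neq0 ?monicXn.
have size_cg : size (c * g) = size f.
  rewrite size_mul // size_Cmul // size_polyXn.
  move: (size_gt0 f f0) (size_gt0 g g0) le_sgf.
  by case: (size f) (size g) => // x [] // y _ _ /= /subnK {2}<-; rewrite addnS.
have lead_cg : lead_coef (c * g) = c0 *: 'X_[e] * lead_coef g.
  by rewrite !lead_coefM lead_coefC lead_coefXn mulr1.
suff [c1 Sc1 E] : exists2 c1, cover_algebra c1 & f - c * g = c1 * g.
  exists (c1 + c); first exact: cover_algebraD.
  by rewrite mulrDl -E subrK.
have fm' := almost_multipleB Sc fm.
have [f'0|f'0] := eqVneq (f - c * g) 0.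
  by rewrite f'0; exists 0; [exact: cover_algebraC | rewrite mul0r].
have le_f'f : (size (f - c * g)%R <= size f)%N.
  by apply: leq_trans (size_polyD _ _) _; rewrite size_polyN size_cg maxnn.
move: le_f'f; rewrite leq_eqVlt => /orP[/eqP eq_size|lt_size]; last first.
  by apply: IHs => //; apply: leq_trans lt_size _.
have lead_f' : lead_coef (f - c * g) = lead_coef f - lead_coef (c * g).
  by rewrite {1}/lead_coef eq_size coefB /lead_coef size_cg.
apply: (IHp (lead_coef (f - c * g))) => //; last by rewrite eq_size.
rewrite -lead_f lead_f' lead_cg; apply: mlead_cancel.
- by rewrite mleadM ?lc0 // mleadZ // mleadXm submK.
- rewrite mleadM ?lc0 // mleadcM mleadcZE mleadXm mcoeffX eqxx mulr1 divfK //.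
  by rewrite mleadc_eq0 lc0.
- by rewrite -lead_cg -lead_f' lc0.
Qed.

(** A fraction f / g that is integral over the cover algebra is almost
    integral: all its powers share the denominator g ^+ (size r).-1. *)
Lemma normal_cover_algebra : normal_subring cover_algebra.
Proof.
move=> f g Sf Sg g0 [r [r_monic Sr root_r]].
set x := tofrac f / tofrac g in root_r *.
have g0' : tofrac g != 0 by rewrite tofrac_eq0.
suff [c Sc fE] : exists2 c, cover_algebra c & f = c * g.
  by exists c => //; rewrite /x fE tofracM mulfK.
pose m := (size r).-1.
(* The leading coefficient of r is 1, so x ^+ m is a combination of lower
   powers. *)
have rE : x ^+ m = \sum_(j < m) tofrac (- r`_j) * x ^+ j.
  move: root_r; rewrite /root horner_coef size_map_poly_id0; last first.
    by rewrite (monicP r_monic) tofrac1 oner_eq0.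
  have size_r : size r = m.+1 by rewrite prednK // size_poly_gt0 monic_neq0.
  rewrite size_r big_ord_recr /= coef_map /=.
  have -> : r`_m = 1 by rewrite -(monicP r_monic) /lead_coef.
  rewrite tofrac1 mul1r addr_eq0 eq_sym eqr_oppLR => /eqP ->.
  rewrite -sumrN; apply: eq_bigr => j _.
  by rewrite coef_map /= tofracN mulNr.
apply: (@cover_algebra_div (g ^+ m)) => //; first by rewrite expf_neq0.
move=> N.
suff [h Sh hE] : exists2 h, cover_algebra h & tofrac (g ^+ m) * x ^+ N = tofrac h.
  exists h => //; apply/eqP; rewrite -tofrac_eq.
  rewrite tofracM [tofrac (h * _)]tofracM -hE -mulrA !tofracXn.
  by rewrite -exprMn /x divfK.
elim/ltn_ind: N => N IHN; have [le_mN|lt_Nm] := leqP m N; last first.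
  exists (g ^+ (m - N) * f ^+ N).
    by apply: cover_algebraM; apply: cover_algebraX.
  rewrite -[in LHS](subnK (ltnW lt_Nm)) exprD !tofracM -mulrA; congr (_ * _).
  by rewrite !tofracXn -exprMn mulrC /x divfK.
have lt_jN (j : 'I_m) : (N - m + j < N)%N by have := ltn_ord j; lia.
have /all_sig2[h Sh hE] (j : 'I_m) := cid2 (IHN _ (lt_jN j)).
exists (\sum_(j < m) - r`_j * h j).
  apply: cover_algebra_sum => j _; rewrite -mulN1r -mulrA -polyC1 -polyCN.
  apply: cover_algebraM; first exact: cover_algebraC.
  exact: cover_algebraM.
rewrite -[in x ^+ N](subnK le_mN) exprD rE mulr_sumr mulr_sumr rmorph_sum.
apply: eq_bigr => j _; rewrite [RHS]tofracM -hE exprD.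
by rewrite [in LHS](mulrCA (x ^+ _)) [LHS]mulrCA.
Qed.

End CoverAlgebra.

(** * The Rees algebra is the cover algebra *)

Section ReesAlgebra.
Variables (K : fieldType) (R : realType) (n q : nat) (v : 'I_q -> 'X_{1..n}).
Variable I : {mpoly K[n]} -> Prop.
Hypothesis I_gen :
  minimally_generates (fun f : {mpoly K[n]} => exists k, f = 'X_[v k]) I.

Lemma pow_cover_ideal k : incl (ideal_pow I k) (cover_ideal v k).
Proof.
elim: k => [|k IHk]; first by move=> x _ m _ C.
apply: ideal_mul_min => [|x y Ix /IHk yk]; first exact: is_ideal_cover.
rewrite -add1n; apply: cover_idealM yk.
case: I_gen => IE _; move/IE: Ix; move: x.
apply: ideal_gen_min => [|_ [l ->] m]; first exact: is_ideal_cover.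
rewrite msuppX inE => /eqP -> C /vertex_coverP/(_ l)[i iC].
by rewrite -lt0n (bigD1 i) //= => vli; rewrite ltn_addr.
Qed.

Hypothesis v_inj : injective v.
Hypothesis v_squarefree : forall k i, (v k i <= 1)%N.
Hypothesis v_neq0 : forall k, mdeg (v k) != 0%N.
Hypothesis v_vars : forall i, exists k, (0 < v k i)%N.
Hypothesis I_unmixed : unmixed (clutter_of v).
Hypothesis I_konig : konig (clutter_of v).

Lemma minimal_cover_through i :
  exists2 C, minimal_vertex_cover (clutter_of v) C & i \in C.
Proof.
have [k vki] := v_vars i.
apply: (@mem_minimal_cover _ _ (mnm_supp (v k))) => [||_ /imsetP[l _ ->]].
- by apply/imsetP; exists k.
- by rewrite inE -lt0n.
- by move=> /(edge_antichain I_gen v_inj v_squarefree) ->.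
Qed.

Definition char_exp (e : {set 'I_n}) : 'X_{1..n} :=
  [multinom nat_of_bool (i \in e) | i < n].

Lemma sum_char_exp (M : {set {set 'I_n}}) : trivIset M -> cover M = setT ->
  forall i, (\sum_(e in M) char_exp e)%MM i = 1%N.
Proof.
move=> trivM coverM i; rewrite mnm_sumE.
transitivity (\sum_(e in M) \sum_(x in e) (x == i))%N.
  apply: eq_bigr => e _; rewrite mnmE; case: (boolP (i \in e)) => ie.
    by rewrite (bigD1 i) //= eqxx big1 // => x /andP[_ /negPf ->].
  by rewrite big1 // => x xe; case: eqP => // E; rewrite -E xe in ie.
rewrite -big_trivIset // coverM (bigD1 i) ?inE //= eqxx big1 // => x.
by case/andP=> _ /negPf ->.
Qed.

Hypothesis a1 :
  integral_polyhedron (set_covering_polyhedron (exponent_matrix R v)).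
Hypothesis a2 : forall i : 'I_n, normal_ideal (elim_var I i).

(** The converse of [pow_cover_ideal] on monomials: either a variable is absent
    from x^a and normality of an elimination ideal concludes, or the product of
    the matched edges, which is the product of all variables, is split off. *)
Lemma mem_pow_covers a b : covers_ge v a b -> ideal_pow I b 'X_[a].
Proof.
have [M [ME trivM coverM cardM]] :=
  konig_perfect_matching I_unmixed I_konig minimal_cover_through.
have [b'] := ubnP b; elim: b' a b => // b' IHb a [//|b] /= lt_b ab.
have [[i ai]|a_gt0] := pselect (exists i, a i = 0%N).
  exact: (mem_pow_zero_coord a1 I_gen ai (a2 _) ab).
have {}a_gt0 i : (0 < a i)%N.
  by rewrite lt0n; apply/negP => /eqP ai; apply: a_gt0; exists i.
(* An empty matching would make the empty set a cover, contradicting b > 0. *)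
have M_gt0 : (0 < #|M|)%N.
  have [|C [minC _]] := @minimal_cover_sub _ (clutter_of v) setT.
    apply/vertex_coverP => k; apply: contrapT => nex; case/eqP: (v_neq0 k).
    rewrite mdegE big1 // => i _; apply/eqP; apply: contrapT => /negP vki.
    by apply: nex; exists i.
  rewrite -(cardM C minC) lt0n cards_eq0; apply/eqP => C0.
  by have := ab C (minsetp minC); rewrite C0 big_set0.
pose a' := [multinom (a i).-1 | i < n].
have aE : a = (a' + \sum_(e in M) char_exp e)%MM.
  by apply/mnmP => i; rewrite mnmDE sum_char_exp // mnmE addn1 prednK.
(* A minimal cover A has #|M| elements, so its sum drops by #|M|; the sum over
   a larger cover is at least that over A. *)
have a'b : covers_ge v a' (b.+1 - #|M|).
  move=> C /minimal_cover_sub[A [minA AC]].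
  apply: (@leq_trans (\sum_(i in A) a' i)); last first.
    rewrite [leqRHS](bigID (mem A)) /=; apply: leq_trans (leq_addr _ _).
    by rewrite leq_eqVlt; apply/orP; left; apply/eqP/eq_bigl => i;
       rewrite andbC; case: (boolP (i \in A)) => // /(subsetP AC) ->.
  rewrite leq_subLR -(cardM A minA) -sum1_card -big_split /=.
  rewrite (eq_bigr a) ?ab ?(minsetp minA) // => i _.
  by rewrite mnmE add1n prednK.
rewrite aE mpolyXD.
have le_b : (b.+1 <= b.+1 - #|M| + #|M|)%N by rewrite addnC -leq_subLR.
apply: (ideal_pow_le le_b).
apply: ideal_powD; first by apply: IHb => //; lia.
rewrite (big_morph _ (@mpolyXD _ _) (@mpolyX0 _ _)) -sum1_card.
apply: ideal_pow_prod => e /(subsetP ME)/imsetP[k _ ->].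
have -> : char_exp (mnm_supp (v k)) = v k.
  by apply/mnmP => i; rewrite mnmE -edge_exp.
exact: ideal_pow1 (edge_ideal_mem I_gen k).
Qed.

Lemma rees_algebraE f : rees_algebra I f <-> cover_algebra v f.
Proof.
split=> Sf k; first exact/pow_cover_ideal/Sf.
rewrite [f`_k]mpolyE big_seq; apply: is_ideal_sum => [|m mf].
  exact: is_ideal_pow.
rewrite -mul_mpolyC; case: (is_ideal_pow I k) => _ _; apply.
exact/mem_pow_covers/Sf.
Qed.

End ReesAlgebra.

Theorem proposition4p31 (K : fieldType) (R : realType) (n q g : nat)
    (v : 'I_q -> 'X_{1..n}) (I : {mpoly K[n]} -> Prop)
    (v_inj : injective v)
    (v_squarefree : forall k i, (v k i <= 1)%N)
    (v_deg : forall k, (2 <= mdeg (v k))%N)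
    (v_vars : forall i, exists k, (0 < v k i)%N)
    (I_gen : minimally_generates
               (fun f : {mpoly K[n]} => exists k, f = 'X_[v k]) I)
    (I_height : has_height I g) (g_ge2 : (2 <= g)%N)
    (I_unmixed : unmixed (clutter_of v))
    (a1 : integral_polyhedron (set_covering_polyhedron (exponent_matrix R v)))
    (a2 : forall i : 'I_n, normal_ideal (elim_var I i))
    (a3 : konig (clutter_of v)) :
  normal_subring (rees_algebra I).
Proof.
have v_neq0 k : mdeg (v k) != 0%N by rewrite -lt0n (leq_trans _ (v_deg k)).
have reesE := rees_algebraE I_gen v_inj v_squarefree v_neq0 v_vars I_unmixed a3
  a1 a2.
move=> f h /reesE Sf /reesE Sh h0 [r [r_monic Sr root_r]].
have [|c Sc fE] := normal_cover_algebra Sf Sh h0.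
  by exists r; split=> // j; apply/reesE.
by exists c => //; apply/reesE.
Qed.
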